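(* Let $\gamma\colon\Omega^\lozenge\to\mathcal{C}$ be any forecasting system. Then (strictly) almost all outcome sequences are computably random for $\gamma$ in the imprecise probability tree that corresponds to $\gamma$; that is, the event $\{\omega\in\Omega\colon \omega\text{ is not computably random for }\gamma\}$ is strictly null for $\gamma$ (and therefore also null for $\gamma$).
   Context: $\mathbb{N}=\{1,2,\dots\}$, $\mathbb{N}_0=\mathbb{N}\cup\{0\}$. A gamble on $\{0,1\}$ is a map $f\colon\{0,1\}\to\mathbb{R}$. $\mathcal{C}$ is the set of all non-empty closed subintervals of $[0,1]$ (interval forecasts; one-point intervals allowed). For $I\in\mathcal{C}$, the upper expectation of $f$ is $\overline{E}_I(f)=\max_{p\in I}[pf(1)+(1-p)f(0)]$. $\Omega=\{0,1\}^{\mathbb{N}}$ is the set of outcome sequences (paths) and $\Omega^\lozenge=\bigcup_{n\in\mathbb{N}_0}\{0,1\}^n$ the set of situations (finite sequences), with $\square$ the empty sequence. For $\omega\in\Omega$, $\omega^n$ denotes its initial segment of length $n$ (so $\omega^0=\square$). A forecasting system is a map $\gamma\colon\Omega^\lozenge\to\mathcal{C}$ (no computability is assumed). A real process is a map $F\colon\Omega^\lozenge\to\mathbb{R}$; its process difference is $\Delta F(s)(x)=F(sx)-F(s)$ for $s\in\Omega^\lozenge$, $x\in\{0,1\}$. A supermartingale for $\gamma$ is a real process $M$ with $\overline{E}_{\gamma(s)}(\Delta M(s))\le 0$ for all $s\in\Omega^\lozenge$. A test supermartingale for $\gamma$ is a non-negative supermartingale $T$ for $\gamma$ with $T(\square)=1$.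 A real process $F$ is computable if there are rational numbers $r_{s,n}=(-1)^{\sigma(s,n)}a(s,n)/b(s,n)$, with $a,b,\sigma\colon\Omega^\lozenge\times\mathbb{N}_0\to\mathbb{N}_0$ computable (by a Turing machine) and $b>0$, and a computable function $e\colon\Omega^\lozenge\times\mathbb{N}_0\to\mathbb{N}_0$, such that $n\ge e(s,N)$ implies $|r_{s,n}-F(s)|\le 2^{-N}$ for all $s\in\Omega^\lozenge$ and $n,N\in\mathbb{N}_0$. An outcome sequence $\omega$ is computably random for $\gamma$ if $\sup_{n\in\mathbb{N}}T(\omega^n)<+\infty$ for every computable test supermartingale $T$ for $\gamma$. An event $A\subseteq\Omega$ is strictly null for $\gamma$ if there is a (not necessarily computable) test supermartingale $T$ for $\gamma$ with $\lim_{n\to+\infty}T(\omega^n)=+\infty$ for all $\omega\in A$. It is null for $\gamma$ if $\overline{E}^\gamma(\mathbb{I}_A)=0$, where $\mathbb{I}_A$ is the indicator of $A$ and, for bounded $g\colon\Omega\to\mathbb{R}$, $\overline{E}^\gamma(g)=\inf\{M(\square)\colon M\text{ a supermartingale for }\gamma\text{ with }\liminf_{n\to+\infty}M(\omega^n)\ge g(\omega)\text{ for all }\omega\in\Omega\}$. A property holds (strictly) almost surely, or for (strictly) almost all outcome sequences, if the set where it fails is (strictly) null. *)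

(* Defs.v *)
From mathcomp Require Import all_boot all_order all_algebra.
From mathcomp Require Import all_classical all_reals all_analysis.

Set Implicit Arguments.
Unset Strict Implicit.
Unset Printing Implicit Defensive.

Import Order.TTheory GRing.Theory Num.Theory.
Import numFieldNormedType.Exports.

Local Open Scope classical_set_scope.
Local Open Scope ring_scope.

(* The outcome space {0,1} is bool, with true for 1 and false for 0. *)

Definition situation : Type := seq bool.

(* w i is the (i+1)-st outcome of the path w. *)
Definition outcome_path : Type := nat -> bool.

Definition initial_segment (w : outcome_path) (n : nat) : situation := mkseq w n.

(** Turing machines: one two-way infinite tape over {blank, 0, 1}; None is the
    blank symbol. *)

Definition symbol : Type := option bool.

(* In the image of delta, None means "halt", and the boolean of
   Some (q, x, d) is the direction of the move: true is right, false is left.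
   The initial state is ord0. *)
Record turing_machine := TuringMachine {
  nstates : nat ;
  delta : {ffun 'I_nstates.+1 * symbol ->
                option ('I_nstates.+1 * symbol * bool)} }.

(* (q, l, r): state q, l the tape to the left of the head (nearest cell first),
   r the tape from the head cell rightwards. All cells not listed are blank. *)
Definition config (M : turing_machine) : Type :=
  ('I_(nstates M).+1 * seq symbol * seq symbol)%type.

Definition step (M : turing_machine) (c : config M) : option (config M) :=
  let: (q, l, r) := c in
  if delta M (q, head None r) is Some (q', x, to_right) then
    Some (if to_right then (q', x :: l, behead r)
          else (q', behead l, head None l :: x :: behead r))
  else None.

(* The input (s, n) is written as s, a blank, and n in unary; the head starts
   on the leftmost of these cells. *)
Definition init_config (M : turing_machine) (s : situation) (n : nat) :
    config M :=
  (ord0, [::], map Some s ++ None :: nseq n (Some true)).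

(* Unary output: the number of consecutive 1s from the head cell rightwards. *)
Definition output (M : turing_machine) (c : config M) : nat :=
  find (predC1 (Some true)) c.2.

Definition computes (M : turing_machine) (f : situation -> nat -> nat) : Prop :=
  forall s n, exists (k : nat) (c : config M),
    [/\ iter k (obind (@step M)) (Some (init_config M s n)) = Some c,
        step c = None & output c = f s n].

Definition computable_fun (f : situation -> nat -> nat) : Prop :=
  exists M : turing_machine, computes M f.

(** Imprecise probability trees. *)

Record interval_forecast (R : realType) := IntervalForecast {
  lower : R ;
  upper : R ;
  lower_ge0 : 0 <= lower ;
  lower_le_upper : lower <= upper ;
  upper_le1 : upper <= 1 }.

Definition forecast_set (R : realType) (I : interval_forecast R) : set R :=
  [set p | lower I <= p <= upper I].

(* The supremum is a maximum: p |-> p f(1) + (1 - p) f(0) is continuous and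
   the interval is compact and non-empty. *)
Definition upper_expectation (R : realType) (I : interval_forecast R)
    (f : bool -> R) : R :=
  sup [set p * f true + (1 - p) * f false | p in forecast_set I].

Definition forecasting_system (R : realType) : Type :=
  situation -> interval_forecast R.

Definition real_process (R : realType) : Type := situation -> R.

Definition process_difference (R : realType) (F : real_process R)
    (s : situation) (x : bool) : R :=
  F (rcons s x) - F s.

Definition supermartingale (R : realType) (gamma : forecasting_system R)
    (M : real_process R) : Prop :=
  forall s, upper_expectation (gamma s) (process_difference M s) <= 0.

Definition test_supermartingale (R : realType) (gamma : forecasting_system R)
    (T : real_process R) : Prop :=
  [/\ supermartingale gamma T, forall s, 0 <= T s & T [::] = 1].

Definition computable_process (R : realType) (F : real_process R) : Prop :=
  exists sigma a b e : situation -> nat -> nat,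
    [/\ computable_fun sigma, computable_fun a, computable_fun b &
        computable_fun e] /\
    (forall s n, (0 < b s n)%N) /\
    forall s n N, (e s N <= n)%N ->
      `|(-1) ^+ sigma s n * ((a s n)%:R / (b s n)%:R) - F s| <= 2 ^- N.

Definition computably_random (R : realType) (gamma : forecasting_system R)
    (w : outcome_path) : Prop :=
  forall T : real_process R,
    test_supermartingale gamma T -> computable_process T ->
    (ereal_sup [set (T (initial_segment w n))%:E | n in [set n | (1 <= n)%N]]
      < +oo)%E.

Definition strictly_null (R : realType) (gamma : forecasting_system R)
    (A : set outcome_path) : Prop :=
  exists T : real_process R, test_supermartingale gamma T /\
    forall w, A w -> T (initial_segment w n) @[n --> \oo] --> +oo.

(* Infimum and limit inferior are taken in the extended reals; for bounded g
   the value is finite. *)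
Definition global_upper_expectation (R : realType)
    (gamma : forecasting_system R) (g : outcome_path -> R) : \bar R :=
  ereal_inf [set (M [::])%:E | M in
    [set M : real_process R | supermartingale gamma M /\
       forall w, ((g w)%:E <=
         limn_einf (fun n => (M (initial_segment w n))%:E))%E]].

Definition null_event (R : realType) (gamma : forecasting_system R)
    (A : set outcome_path) : Prop :=
  global_upper_expectation gamma (\1_A : outcome_path -> R) = 0%E.

(* Main.v *)
Require Import Defs.
From mathcomp Require Import all_boot all_order all_algebra.
From mathcomp Require Import all_classical all_reals all_analysis.
From mathcomp Require Import lra.

(** There are countably many Turing machines, hence countably many computable
    test supermartingales T_k. The plain mixture of the T_k may diverge (an
    outcome of upper probability 0 allows arbitrarily large jumps), and
    unboundedness of T_k along a path does not give divergence to infinity. Both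
    defects disappear when each (1 + T_k) / 2 is replaced by the capital of a
    gambler who banks the gains at every doubling and restarts from stake 1: this
    capital is at most |s| + 2 in the situation s, uniformly in k, and it tends to
    infinity along every path on which T_k is unbounded. The mixture with weights
    2^-(k+1) then witnesses strict nullity.

    A strictly null event is null because e * T is an admissible supermartingale
    for every e > 0, while every supermartingale is bounded by its initial value
    along some path. *)

Set Implicit Arguments.
Unset Strict Implicit.
Unset Printing Implicit Defensive.

Import Order.TTheory GRing.Theory Num.Theory.
Import numFieldNormedType.Exports.

Local Open Scope classical_set_scope.
Local Open Scope ring_scope.

(** * Countability of the computable processes *)

(** The run is deterministic, and a halted configuration has no successor, so two halting runs on
    the same input stop in the same configuration. *)
Lemma computes_functional (M : turing_machine) (f g : situation -> nat -> nat) :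
  computes M f -> computes M g -> f = g.
Proof.
move=> Mf Mg; apply/funext => s; apply/funext => n.
have [k [c [kc hc <-]]] := Mf s n; have [l [d [ld hd <-]]] := Mg s n.
have stuck i (c' : config M) : step c' = None ->
    iter i.+1 (obind (@step M)) (Some c') = None.
  by move=> hc'; elim: i => [|i IH]; [exact: hc' | rewrite iterS IH].
have halt_eq i j (c' d' : config M) : (i <= j)%N -> step c' = None ->
    iter i (obind (@step M)) (Some (init_config M s n)) = Some c' ->
    iter j (obind (@step M)) (Some (init_config M s n)) = Some d' -> c' = d'.
  move=> /subnK <- hc' ic'; rewrite iterD ic'.
  by case: (j - i)%N => [[]//|m]; rewrite stuck.
have [kl|/ltnW lk] := leqP k l; first by rewrite (halt_eq _ _ _ _ kl hc kc ld).
by rewrite (halt_eq _ _ _ _ lk hd ld kc).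
Qed.

(** A machine is a finite table, hence has a numerical code. Each code is sent to the unique
    function that its machine computes, and to the zero function if there is none. *)
Lemma enum_computable_fun :
  exists g : nat -> situation -> nat -> nat,
    forall f, computable_fun f -> exists i, g i = f.
Proof.
pose code := {n : nat &
  {ffun 'I_n.+1 * symbol -> option ('I_n.+1 * symbol * bool)}}.
pose tm (x : code) := TuringMachine (tagged x).
exists (fun i => if (unpickle i : option code) is Some x
  then xget (fun _ _ => 0%N) [set f | computes (tm x) f] else fun _ _ => 0%N).
move=> f [[n d] Mf]; pose x : code := Tagged _ d.
exists (pickle x); rewrite pickleK.
case: xgetP => [h _ Mh|/(_ f)]; last by case.
exact: computes_functional Mh Mf.
Qed.

(** A computable process is the pointwise limit of its rational approximations, so the indices of
    [sigma], [a] and [b] determine it. *)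
Lemma enum_computable_process (R : realType) :
  exists e : nat -> real_process R,
    forall F, computable_process F -> exists k, e k = F.
Proof.
have [g gP] := enum_computable_fun.
exists (fun k s => if (unpickle k : option (nat * nat * nat)) is Some (i, j, l)
  then lim (((-1) ^+ g i s n * ((g j s n)%:R / (g l s n)%:R) : R) @[n --> \oo])
  else 0).
move=> F [sigma [a [b [e [[/gP[i <-] /gP[j <-] /gP[l <-] _] [_ eF]]]]]].
exists (pickle (i, j, l)); rewrite pickleK; apply/funext => s.
apply/cvg_lim => //; apply/cvgrPdist_le => /= eps eps0.
have [N _ NP] := near_infty_natSinv_expn_lt (PosNum eps0).
near=> n; rewrite distrC.
apply: le_trans (eF s n N _) _; first by near: n; exact: nbhs_infty_ge.
by have := NP N (leqnn _); rewrite /= div1r => /ltW.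
Unshelve. all: by end_near. Qed.

(** * Supermartingales as pointwise inequalities over the forecast interval *)

Section supermartingale_theory.
Context {R : realType}.
Implicit Types (gamma : forecasting_system R) (M : real_process R).

Lemma upper_expectation_le0 (I : interval_forecast R) (f : bool -> R) :
  upper_expectation I f <= 0 <->
  forall p, forecast_set I p -> p * f true + (1 - p) * f false <= 0.
Proof.
split=> [fI p Ip|fI].
  apply: le_trans fI; apply: ub_le_sup; last by exists p.
  exists (`|f true| + `|f false|) => _ [q /andP[q0 q1] <-].
  have := lower_ge0 I; have := upper_le1 I => u1 l0.
  by apply: lerD; apply: le_trans (ler_norm _) _; rewrite normrM;
    apply: ler_piMl => //; rewrite ger0_norm; lra.
apply: ge_sup; last by move=> _ [p Ip <-]; exact: fI.
exists (lower I * f true + (1 - lower I) * f false); exists (lower I) => //.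
by rewrite /forecast_set /= lexx lower_le_upper.
Qed.

Lemma supermartingaleP gamma M : supermartingale gamma M <->
  forall s p, forecast_set (gamma s) p ->
    p * M (rcons s true) + (1 - p) * M (rcons s false) <= M s.
Proof.
rewrite /supermartingale /process_difference.
split=> [MM s p Ip|MM s].
  by have /upper_expectation_le0/(_ p Ip) := MM s; lra.
by apply/upper_expectation_le0 => p Ip; have := MM s p Ip; lra.
Qed.

Lemma forecast_weights gamma s p :
  forecast_set (gamma s) p -> 0 <= p /\ 0 <= 1 - p.
Proof.
move=> /andP[lp pu]; have := lower_ge0 (gamma s); have := upper_le1 (gamma s).
by split; lra.
Qed.

Lemma supermartingale_cst gamma (c : R) : supermartingale gamma (fun=> c).
Proof. by apply/supermartingaleP => s p _; lra. Qed.

Lemma supermartingaleZ gamma M (c : R) : 0 <= c ->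
  supermartingale gamma M -> supermartingale gamma (fun s => c * M s).
Proof.
move=> c0 /supermartingaleP MM; apply/supermartingaleP => s p Ip.
by have := ler_wpM2l c0 (MM s p Ip); lra.
Qed.

Lemma initial_segmentS (w : outcome_path) n :
  initial_segment w n.+1 = rcons (initial_segment w n) (w n).
Proof. by rewrite /initial_segment /mkseq -addn1 iotaD map_cat cats1. Qed.

(** A convex combination of two numbers cannot lie below both, so in every situation some outcome
    does not raise the capital; the path always takes such an outcome. *)
Lemma supermartingale_nonincreasing_path gamma M : supermartingale gamma M ->
  exists w : outcome_path, forall n, M (initial_segment w n) <= M [::].
Proof.
move=> /supermartingaleP MM.
pose next s := M (rcons s true) <= M s.
have nextP s : M (rcons s (next s)) <= M s.
  rewrite /next; case: (leP (M (rcons s true))) => // Mt; rewrite leNgt.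
  apply/negP => Mf.
  have [p Ip] : exists p, forecast_set (gamma s) p.
    by exists (lower (gamma s)); rewrite /forecast_set /= lexx lower_le_upper.
  have [p0 q0] := forecast_weights Ip; have := MM _ _ Ip.
  (* One of the weights [p] and [1 - p] is at least 1/2, which makes the average strictly larger
     than [M s]. *)
  by have [ph|ph] := leP p (1 / 2); nra.
pose pref n := iter n (fun s => rcons s (next s)) [::].
pose w : outcome_path := fun n => next (pref n).
have prefE n : initial_segment w n = pref n.
  by elim: n => [|n IH]; [|rewrite initial_segmentS IH].
exists w => n; rewrite prefE; elim: n => // n; apply: le_trans; exact: nextP.
Qed.

(** * Countable mixtures of test supermartingales *)

(** The weights are 2^-(k+1), with sum 1. The bound [B], uniform in [k], makes the series converge
    in every situation, and the supermartingale inequality passes to the limit term by term. *)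
Lemma mixture_test_supermartingale gamma (T : nat -> real_process R)
    (B : situation -> R) :
  (forall k, test_supermartingale gamma (T k)) -> (forall k s, T k s <= B s) ->
  exists2 V, test_supermartingale gamma V &
    forall k s, geometric (1 / 2) (1 / 2) k * T k s <= V s.
Proof.
move=> TT TB; pose g : R^nat := geometric (1 / 2) (1 / 2).
have g0 k : 0 <= g k by rewrite /g /= mulr_ge0 ?exprn_ge0.
have hlt1 : `|1 / 2 : R| < 1 by rewrite ger0_norm; lra.
have u0 k s : 0 <= g k * T k s by have [_ T0 _] := TT k; rewrite mulr_ge0.
have B0 s : 0 <= B s by apply: le_trans (TB 0%N s); have [_ T0 _] := TT 0%N.
have cv s : cvgn (series (fun k => g k * T k s)).
  apply: (@series_le_cvg _ _ (B s *: g)) => // [k|k|].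
  - by rewrite /= mulr_ge0.
  - by rewrite /= [X in _ <= X]mulrC ler_wpM2l.
  - by apply: is_cvg_seriesZ; apply: is_cvg_geometric_series.
have nd s : {homo series (fun k => g k * T k s) : n m / (n <= m)%N >-> n <= m}.
  by apply: nondecreasing_series => k _ _.
exists (fun s => limn (series (fun k => g k * T k s))); last first.
  move=> k s; apply: le_trans (nondecreasing_cvgn_le (nd s) (cv s) k.+1).
  by rewrite seriesSr lerDr (le_trans _ (nd s 0%N k _))// /series /= big_geq.
split.
- apply/supermartingaleP => s p Ip; have [p0 q0] := forecast_weights Ip.
  have limZ c t : c * limn (series (fun k => g k * T k t)) =
      limn (series (c *: (fun k => g k * T k t))).
    by rewrite lim_seriesZ.
  rewrite !limZ -lim_seriesD; last 2 first.
  + exact: is_cvg_seriesZ.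
  + exact: is_cvg_seriesZ.
  apply: lim_series_le => // [|k].
    apply: is_cvg_seriesD; exact: is_cvg_seriesZ.
  have [/supermartingaleP/(_ s p Ip) Tk _ _] := TT k.
  suff : p * (g k * T k (rcons s true)) + (1 - p) * (g k * T k (rcons s false))
    <= g k * T k s by [].
  by have := ler_wpM2l (g0 k) Tk; move: (g k) => c; lra.
- move=> s; apply: le_trans (nondecreasing_cvgn_le (nd s) (cv s) 0%N).
  by rewrite /series /= big_geq.
- have -> : (fun k => g k * T k [::]) = g.
    by apply/funext => k; have [_ _ ->] := TT k; rewrite mulr1.
  apply/cvg_lim => //; have := @cvg_geometric_series R (1 / 2) (1 / 2) hlt1.
  have -> : 1 - 1 / 2 = 1 / 2 :> R by lra.
  by rewrite divff // gt_eqF //; lra.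
Qed.

(** * The strategy that banks gains *)

(* The state is (number of withdrawals so far, value of [U] at the last one);
   the recursion runs over the situation read backwards. *)
Fixpoint savings_rev (U : real_process R) (r : seq bool) : nat * R :=
  if r is x :: r' then
    let mb := savings_rev U r' in
    if 2 * mb.2 <= U (rev r) then (mb.1.+1, U (rev r)) else mb
  else (0%N, 1).

Definition savings U s := savings_rev U (rev s).

(** Each withdrawal banks exactly one unit and resets the stake to 1, the stake being [U] divided by
    its value at the last withdrawal. Any excess of the stake over 2 is discarded, which keeps the
    capital bounded uniformly in [U]. *)
Definition saved_capital U s := (savings U s).1%:R + U s / (savings U s).2.

Lemma savings_rcons U s x : savings U (rcons s x) =
  if 2 * (savings U s).2 <= U (rcons s x)
  then ((savings U s).1.+1, U (rcons s x)) else savings U s.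
Proof. by rewrite /savings rev_rcons /= rev_cons revK. Qed.

Section savings_theory.
Variables (U : real_process R).
Hypotheses (U0 : forall s, 0 < U s) (U1 : U [::] = 1).

Lemma savings_base_gt0 s : 0 < (savings U s).2.
Proof.
elim/last_ind: s => [|s x IH]; first exact: ltr01.
by rewrite savings_rcons; case: ifP => _; [exact: U0 | exact: IH].
Qed.

Lemma ltr_savings_base s : U s < 2 * (savings U s).2.
Proof.
elim/last_ind: s => [|s x IH]; first by rewrite U1 /=; lra.
rewrite savings_rcons; case: ifPn => [_|]; last by rewrite -ltNge.
by have /= := U0 (rcons s x); lra.
Qed.

Lemma savings_size s : ((savings U s).1 <= size s)%N.
Proof.
elim/last_ind: s => // s x IH; rewrite savings_rcons size_rcons.
by case: ifP => // _; apply: leq_trans IH _.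
Qed.

Lemma saved_capital_ge s : (savings U s).1%:R <= saved_capital U s.
Proof. by rewrite lerDl divr_ge0 // ltW // savings_base_gt0. Qed.

Lemma saved_capital_le s : saved_capital U s <= (size s)%:R + 2.
Proof.
rewrite lerD ?ler_nat ?savings_size // ler_pdivrMr ?savings_base_gt0 //.
exact/ltW/ltr_savings_base.
Qed.

Lemma test_saved_capital gamma :
  supermartingale gamma U -> test_supermartingale gamma (saved_capital U).
Proof.
move=> /supermartingaleP MU; split; last first.
- by rewrite /saved_capital /= U1 divr1 add0r.
- by move=> s; apply: le_trans (saved_capital_ge s).
apply/supermartingaleP => s p Ip; have [p0 q0] := forecast_weights Ip.
set b := (savings U s).2; set m : R := (savings U s).1%:R.
have b0 : 0 < b := savings_base_gt0 s.
(* A withdrawal never adds capital: it turns a stake of at least 2 into one banked unit and a stake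
   of 1. *)
have step x : saved_capital U (rcons s x) <= m + U (rcons s x) / b.
  rewrite /saved_capital savings_rcons -/b -/m; case: ifP => //= bU.
  rewrite divff ?gt_eqF // -natr1 -/m -addrA lerD2l ler_pdivlMr //; lra.
have := MU s p Ip; have := step true; have := step false.
move=> hf ht hU.
apply: (@le_trans _ _ (p * (m + U (rcons s true) / b) +
  (1 - p) * (m + U (rcons s false) / b))).
  by apply: lerD; apply: ler_wpM2l.
have b1 : 0 <= b^-1 by rewrite invr_ge0 ltW.
have := ler_wpM2r b1 hU; rewrite /saved_capital -/m -/b.
by move: (b^-1) => c; lra.
Qed.

Lemma savings_mono (w : outcome_path) n k : (n <= k)%N ->
  ((savings U (initial_segment w n)).1 <= (savings U (initial_segment w k)).1)%N
  /\ (savings U (initial_segment w n)).2 <= (savings U (initial_segment w k)).2.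
Proof.
elim: k => [|k IH]; first by rewrite leqn0 => /eqP ->.
rewrite leq_eqVlt => /predU1P[->//|/IH[h1 h2]].
rewrite initial_segmentS savings_rcons; case: ifP => //= bU.
split; first exact: leqW.
by apply: le_trans h2 _; have := savings_base_gt0 (initial_segment w k); lra.
Qed.

Lemma savings_stable (w : outcome_path) n k : (n <= k)%N ->
  savings U (initial_segment w k) = savings U (initial_segment w n) \/
  ((savings U (initial_segment w n)).1 <
    (savings U (initial_segment w k)).1)%N.
Proof.
elim: k => [|k IH]; first by rewrite leqn0 => /eqP ->; left.
rewrite leq_eqVlt => /predU1P[->|/IH]; first by left.
rewrite initial_segmentS savings_rcons; case: ifP => //= _ [->|]; right => //.
exact: ltnW.
Qed.

Lemma saved_capital_cvgy (w : outcome_path) :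
  (forall A, exists n, A <= U (initial_segment w n)) ->
  saved_capital U (initial_segment w n) @[n --> \oo] --> +oo.
Proof.
move=> Uw.
have reach m : exists n, (m <= (savings U (initial_segment w n)).1)%N.
  elim: m => [|m [n mn]]; first by exists 0%N.
  (* At time [k] the value of [U] is at least twice the base of time [n]. Since the stake is always
     below 2, the base has grown since, so a further withdrawal took place. *)
  have [k hk] := Uw (2 * (savings U (initial_segment w n)).2).
  have Uk := ltr_savings_base (initial_segment w k).
  have [kn|/ltnW nk] := leqP k n.
    by have [_ ?] := savings_mono w kn; lra.
  case: (savings_stable w nk) => [E|]; first by move: Uk; rewrite E; lra.
  by exists k; apply: leq_ltn_trans mn _.
apply/cvgryPge => A; have [n mn] := reach (Num.truncn A).+1.
exists n => // k /= nk.
apply: le_trans (saved_capital_ge _).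
have [h _] := savings_mono w nk.
apply: (@le_trans _ _ (Num.truncn A).+1%:R); first exact/ltW/truncnS_gt.
by rewrite ler_nat; apply: leq_trans h.
Qed.

End savings_theory.

(** * Strict nullity of unboundedness for a sequence of test supermartingales *)

Lemma supermartingale_average gamma M c : supermartingale gamma M ->
  supermartingale gamma (fun s => (c + M s) / 2).
Proof.
by move=> /supermartingaleP MM; apply/supermartingaleP => s p /MM; lra.
Qed.

Lemma strictly_null_unbounded gamma (T : nat -> real_process R) :
  (forall k, test_supermartingale gamma (T k)) ->
  strictly_null gamma [set w | exists k, forall A,
    exists n, A <= T k (initial_segment w n)].
Proof.
(* Averaging with 1 keeps the capital positive, so that it can be rescaled. *)
move=> TT; pose U k : real_process R := fun s => (1 + T k s) / 2.
have U0 k s : 0 < U k s by have [_ /(_ s) T0 _] := TT k; rewrite /U; lra.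
have U1 k : U k [::] = 1 by have [_ _ T1] := TT k; rewrite /U T1; lra.
have SU k : test_supermartingale gamma (saved_capital (U k)).
  apply: test_saved_capital => //; apply: supermartingale_average.
  by have [] := TT k.
have [V TV geV] := mixture_test_supermartingale SU
  (fun k => saved_capital_le (U0 k) (U1 k)).
exists V; split => // w [k Tw].
have Uw A : exists n, A <= U k (initial_segment w n).
  by have [n nP] := Tw (2 * A); exists n; rewrite /U; lra.
have /cvgryPge cvU := saved_capital_cvgy (U0 k) (U1 k) Uw.
apply/cvgryPge => A.
have g0 : 0 < geometric (1 / 2) (1 / 2) k :> R.
  by rewrite /= mulr_gt0 ?exprn_gt0.
near=> n; apply: le_trans (geV k _); rewrite mulrC -ler_pdivrMr //.
by near: n; exact: cvU.
Unshelve. all: by end_near. Qed.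

(** * From strictly null to null *)

Lemma limn_einf_le (u : (\bar R)^nat) (c : \bar R) :
  (forall n, (u n <= c)%E) -> (limn_einf u <= c)%E.
Proof.
move=> uc; rewrite limn_einf_lim; apply: lime_le; first exact: is_cvg_einfs.
by apply: nearW => n; apply: ge_ereal_inf; exists (u n) => //; exists n => /=.
Qed.

Lemma limn_einf_ge (u : (\bar R)^nat) (c : \bar R) :
  (forall n, (c <= u n)%E) -> (c <= limn_einf u)%E.
Proof.
move=> uc; rewrite limn_einf_lim; apply: lime_ge; first exact: is_cvg_einfs.
by apply: nearW => n; apply/ereal_infP => _ [k _ <-].
Qed.

Lemma strictly_null_null gamma (A : set outcome_path) :
  strictly_null gamma A -> null_event gamma A.
Proof.
move=> [T [[MT T0 T1] TA]]; apply/eqP; rewrite eq_le; apply/andP; split.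
  apply/lee_addgt0Pr => eps eps0; rewrite add0e.
  apply: ge_ereal_inf; exists eps%:E => //.
  exists (fun s => eps * T s); last by rewrite T1 mulr1.
  split; first exact/supermartingaleZ/MT/ltW.
  move=> w; rewrite indicE; have [/set_mem/TA Tw|_] := boolP (w \in A).
    have : (eps * T (initial_segment w n))%:E @[n --> \oo] --> +oo%E.
      apply/cvgeryP/cvgryPge => B; move/cvgryPge/(_ (B / eps)): Tw.
      by apply: filterS => n; rewrite ler_pdivrMr // mulrC.
    by move/cvg_limn_einf_sup => [-> _]; exact: leey.
  by apply: limn_einf_ge => n; rewrite lee_fin mulr_ge0 // ltW.
apply/ereal_infP => _ [M [MM geM] <-].
have [w wM] := supermartingale_nonincreasing_path MM.
apply: (@le_trans _ _ (\1_A w)%:E); first by rewrite lee_fin indicE ler0n.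
by apply: le_trans (geM w) _; apply: limn_einf_le => n; rewrite lee_fin.
Qed.

End supermartingale_theory.

Theorem theorem6 (R : realType) (gamma : forecasting_system R) :
  strictly_null gamma [set w | ~ computably_random gamma w] /\
  null_event gamma [set w | ~ computably_random gamma w].
Proof.
suff N : strictly_null gamma [set w | ~ computably_random gamma w].
  by split; [|exact: strictly_null_null].
have [e eP] := enum_computable_process R.
(* Entries of the enumeration that are not test supermartingales for [gamma] are replaced by the
   constant 1. *)
pose T k : real_process R :=
  if `[< test_supermartingale gamma (e k) >] then e k else fun=> 1.
have TT k : test_supermartingale gamma (T k).
  rewrite /T; case: asboolP => // _.
  by split=> //; exact: supermartingale_cst.
have [V [TV VP]] := strictly_null_unbounded TT.
exists V; split => // w; rewrite /computably_random /= => nw; apply: VP.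
apply: contrapT => bounded; apply: nw => F TF /eP[k ekF].
have TkF : T k = F by rewrite /T ekF; case: asboolP.
have [A FA] : exists A, forall n, F (initial_segment w n) <= A.
  apply: contrapT => nA; apply: bounded; exists k => A; apply: contrapT => nn.
  apply: nA; exists A => n; rewrite leNgt; apply/negP => /ltW An.
  by apply: nn; exists n; rewrite TkF.
apply: (@le_lt_trans _ _ A%:E); last exact: ltry.
by apply/ereal_supP => _ [n _ <-]; rewrite lee_fin.
Qed.
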